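(* Let $a_2\in S^2(\mathbb{R}^n\times\mathbb{R}^n)$ be non-negative, let $a(x,\xi)=a_2(x,\xi)+|x|^2$, $m(x,\xi)=a(x,\xi)+\langle X\rangle$ with $X=(x,\xi)$, and let $g$ be the metric $$g_X(dx,d\xi)=m^{-1}(x,\xi)\,(\langle\xi\rangle^2+|x|^2)\,dx^2+m^{-1}(x,\xi)\,d\xi^2 .$$ Then $m$ is a $g$-weight.
   Context: Notation: $\langle\xi\rangle=(1+|\xi|^2)^{1/2}$, $\langle X\rangle=(1+|x|^2+|\xi|^2)^{1/2}$ for $X=(x,\xi)$. $S^2(\mathbb{R}^n\times\mathbb{R}^n)$ is the Kohn–Nirenberg class of smooth functions $b$ with $|\partial_x^\beta\partial_\xi^\alpha b(x,\xi)|\le C_{\alpha,\beta}(1+|\xi|)^{2-|\alpha|}$ for all multi-indices $\alpha,\beta$ and all $(x,\xi)$. For $T=(t,\tau)$, $g_X=A(X)dx^2+B(X)d\xi^2$ means $g_X(T)=A(X)|t|^2+B(X)|\tau|^2$. Symplectic form: $\sigma(Y,Z)=\langle z,\eta\rangle-\langle y,\zeta\rangle$ for $Y=(y,\eta)$, $Z=(z,\zeta)$, and $g_X^\sigma(T)=\sup_{W\ne0}\sigma(T,W)^2/g_X(W)$. A function $M:\mathbb{R}^{2n}\to(0,\infty)$ is a $g$-weight if it is $g$-continuous: there is $\tilde C>0$ such that $g_X(X-Y)\le 1/\tilde C$ implies $(M(X)/M(Y))^{\pm1}\le\tilde C$ for all $X,Y$; and $g$-temperate: there are $\tilde C>0$,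 $N\in\mathbb{N}$ such that $(M(X)/M(Y))^{\pm1}\le\tilde C(1+g_Y^\sigma(X-Y))^N$ for all $X,Y\in\mathbb{R}^{2n}$. *)

(* Defs.v *)
From HB Require Import structures.
From mathcomp Require Import all_boot all_order all_algebra.
From mathcomp Require Import all_classical all_reals all_analysis.
Import Order.TTheory GRing.Theory Num.Theory.
Import numFieldNormedType.Exports.

Set Implicit Arguments.
Unset Strict Implicit.
Unset Printing Implicit Defensive.

Local Open Scope ring_scope.

(* A point X = (x, xi) of R^n x R^n is a pair of row vectors. The library norm
   `|x| on 'rV[R]_n is the sup norm, hence the separate Euclidean norm. *)
Notation phase R n := ('rV[R]_n * 'rV[R]_n)%type.

Definition dotp (R : realType) (n : nat) (u v : 'rV[R]_n) : R :=
  \sum_(i < n) u ord0 i * v ord0 i.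

Definition enorm (R : realType) (n : nat) (u : 'rV[R]_n) : R :=
  Num.sqrt (dotp u u).

Definition japanese (R : realType) (n : nat) (xi : 'rV[R]_n) : R :=
  Num.sqrt (1 + enorm xi ^+ 2).

Definition japanese_phase (R : realType) (n : nat) (X : phase R n) : R :=
  Num.sqrt (1 + enorm X.1 ^+ 2 + enorm X.2 ^+ 2).

(* inl i is the direction of x_i and inr i is the direction of xi_i *)
Definition basis_vector (R : realType) (n : nat) (d : 'I_n + 'I_n) : phase R n :=
  match d with
  | inl i => (delta_mx ord0 i, 0)
  | inr i => (0, delta_mx ord0 i)
  end.

Definition partial (R : realType) (n : nat) (d : 'I_n + 'I_n)
    (f : phase R n -> R) : phase R n -> R :=
  fun X => 'D_(basis_vector R d) f X.

(* C^oo: the partial derivatives of all orders, taken in any order, exist and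
   are (Frechet) differentiable at every point *)
Definition smooth (R : realType) (n : nat) (f : phase R n -> R) : Prop :=
  forall (s : seq ('I_n + 'I_n)) (X : phase R n),
    differentiable (foldr (@partial R n) f s) X.

Definition multi_index (n : nat) := {ffun 'I_n -> nat}.

Definition mi_order (n : nat) (alpha : multi_index n) : nat :=
  (\sum_(i < n) alpha i)%N.

Definition partial_multi (R : realType) (n : nat) (side : 'I_n -> 'I_n + 'I_n)
    (alpha : multi_index n) (f : phase R n -> R) : phase R n -> R :=
  foldr (fun i h => iter (alpha i) (partial (side i)) h) f (enum 'I_n).

Definition partial_x (R : realType) (n : nat) (beta : multi_index n)
    (f : phase R n -> R) : phase R n -> R :=
  partial_multi (fun i => inl i) beta f.

Definition partial_xi (R : realType) (n : nat) (alpha : multi_index n)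
    (f : phase R n -> R) : phase R n -> R :=
  partial_multi (fun i => inr i) alpha f.

(* The (real-valued) symbols of the Kohn-Nirenberg class S^k; the exponent
   k - |alpha| is an integer and may be negative. *)
Definition kohn_nirenberg (R : realType) (n : nat) (k : int)
    (b : phase R n -> R) : Prop :=
  smooth b /\
  forall alpha beta : multi_index n, exists C : R, forall X : phase R n,
    `|partial_x beta (partial_xi alpha b) X|
      <= C * (1 + enorm X.2) ^ (k - (mi_order alpha)%:Z).

(* A metric is given by its quadratic forms: g X T is g_X(T). *)
Definition split_metric (R : realType) (n : nat) (A B : phase R n -> R)
    (X T : phase R n) : R :=
  A X * enorm T.1 ^+ 2 + B X * enorm T.2 ^+ 2.

Definition symp (R : realType) (n : nat) (Y Z : phase R n) : R :=
  dotp Z.1 Y.2 - dotp Y.1 Z.2.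

Definition dual_metric (R : realType) (n : nat) (g : phase R n -> phase R n -> R)
    (X T : phase R n) : \bar R :=
  ereal_sup [set (symp T W ^+ 2 / g X W)%:E | W in [set W | W != 0]]%classic.

Definition g_continuous (R : realType) (n : nat)
    (g : phase R n -> phase R n -> R) (M : phase R n -> R) : Prop :=
  exists2 C : R, 0 < C & forall X Y : phase R n,
    g X (X - Y) <= 1 / C -> M X / M Y <= C /\ (M X / M Y)^-1 <= C.

Definition g_temperate (R : realType) (n : nat)
    (g : phase R n -> phase R n -> R) (M : phase R n -> R) : Prop :=
  exists2 C : R, 0 < C & exists N : nat, forall X Y : phase R n,
    let bound := (C%:E * (1 + dual_metric g Y (X - Y)%R) ^+ N)%E in
    ((M X / M Y)%:E <= bound)%E /\ ((M X / M Y)^-1%:E <= bound)%E.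

Definition g_weight (R : realType) (n : nat)
    (g : phase R n -> phase R n -> R) (M : phase R n -> R) : Prop :=
  [/\ forall X : phase R n, 0 < M X, g_continuous g M & g_temperate g M].

(* Main.v *)
Require Import Defs.
From HB Require Import structures.
From mathcomp Require Import all_boot all_order all_algebra.
From mathcomp Require Import all_classical all_reals all_analysis.
From mathcomp Require Import ring lra.
Import Order.TTheory GRing.Theory Num.Theory.
Import numFieldNormedType.Exports.

Local Open Scope ring_scope.

(** Write L = <X> and Q_X(T) = L^2 |t|^2 + |tau|^2 for T = (t, tau), so that
    g_X = Q_X / m(X), and note L <= m.  Everything rests on one estimate
    [symbol_weight_increment]: there are E and N such that
<<
      |m(X + s T) - m(X)| <= E s (1 + s)^N m(X)   if s >= 0 and g_X(T) <= 1.
>>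
    The terms |x|^2 and <X> of m satisfy it by elementary algebra.  For a2 the
    reason is positivity: a nonnegative function f of one variable with
    |f''| <= K has |c f'(0)| <= f(0) + K c^2 for every c, because f(c) and f(-c)
    cannot be negative; hence its increment over [0, s c] is controlled by f(0)
    and K c^2 alone, see [nonneg_increment].  This is applied along one coordinate
    axis at a time, first the x_i and then the xi_i.  Only the pure second
    derivatives of a2 are involved; they are O(1 + |xi|^2) in x_i, where xi stays
    equal to its initial value during the first half of the walk, and O(1) in
    xi_i.  When g_X(T) <= 1 the quantity K c^2 is therefore O(m(X)) at every one
    of the 2n moves, and the increments compose like a discrete Gronwall
    inequality into the factor (1 + s)^(2n) ([row_increment],
    [symbol_increment]).

    For small s the estimate says that m(X) and m(Y) are comparable when
    g_X(X - Y) is small, which is g-continuity.  For s = 1 + O(g_Y(X - Y)) it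
    bounds m(X) / m(Y) by a power of 1 + g_Y(X - Y); this is one half of
    temperance, since g_Y <= g_Y^sigma, the dual metric being
    g_Y^sigma = (m(Y) / <Y>)^2 g_Y.  For the other half it may be assumed that
    g_Y(X - Y) is bounded below; then g_Y^sigma(X - Y) dominates
    (m(Y) / <Y>)^2, so m(Y) is at most <Y> times a power of
    1 + g_Y^sigma(X - Y), and <Y> is at most <X> <= m(X) times another such
    power ([weight_ge_temperate]). *)

(** * Nonnegative functions of one variable with bounded second derivative *)

(** The location of c is kept only as a distance to a, which is what makes the
    order of a and b irrelevant. *)
Lemma MVT_any_order {R : realType} {f df : R -> R}
    (fd : forall x : R, is_derive x 1 f (df x)) (a b : R) :
  exists2 c : R, `|c - a| <= `|b - a| & f b - f a = df c * (b - a).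
Proof.
have fcont (u v : R) : {within `[u, v], continuous f}%classic.
  apply: derivable_within_continuous => x _.
  exact: (@ex_derive _ _ _ _ _ _ _ (fd x)).
have [ab|ba] := leP a b.
- have [c cab fE] := MVT_segment ab (fun x _ => fd x) (fcont a b).
  exists c => //; move: cab; rewrite in_itv /= => /andP[ac cb].
  by rewrite !ger0_norm ?subr_ge0// lerB.
- have [c cba fE] := MVT_segment (ltW ba) (fun x _ => fd x) (fcont b a).
  exists c; last by lra.
  move: cba; rewrite in_itv /= => /andP[bc ca].
  by rewrite !ler0_norm ?subr_le0 ?(ltW ba)// lerN2 lerB.
Qed.

(** The constant K instead of K / 2 comes from applying the mean value theorem
    twice; constants are immaterial below. *)
Lemma taylor1_bound {R : realType} {f df ddf : R -> R} {K : R}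
    (fd : forall x : R, is_derive x 1 f (df x))
    (dfd : forall x : R, is_derive x 1 df (ddf x))
    (ddfK : forall x : R, `|ddf x| <= K) (r : R) :
  `|f r - f 0 - r * df 0| <= K * r ^+ 2.
Proof.
have [c] := MVT_any_order fd 0 r; rewrite !subr0 => cr ->.
have [d _] := MVT_any_order dfd 0 c; rewrite subr0 => dfE.
have -> : df c * r - r * df 0 = ddf d * c * r by rewrite -dfE; ring.
rewrite !normrM -mulrA ler_pM//.
by rewrite -[leRHS]real_normK ?num_real// expr2 ler_wpM2r.
Qed.

(** The constraints f c >= 0 and f (- c) >= 0, inserted in the first-order Taylor
    bound, control the slope: |c f'(0)| <= f(0) + K c^2.  Taylor's bound at s c
    then gives the increment. *)
Lemma nonneg_increment {R : realType} {f df ddf : R -> R} {K : R}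
    (fd : forall x : R, is_derive x 1 f (df x))
    (dfd : forall x : R, is_derive x 1 df (ddf x))
    (ddfK : forall x : R, `|ddf x| <= K)
    (f_ge0 : forall x : R, 0 <= f x) (c s : R) (s_ge0 : 0 <= s) :
  `|f (s * c) - f 0| <= s * (f 0 + K * c ^+ 2 * (1 + s)).
Proof.
have := taylor1_bound fd dfd ddfK c.
have := taylor1_bound fd dfd ddfK (- c).
have := taylor1_bound fd dfd ddfK (s * c).
rewrite !ler_norml => /andP[lo hi] /andP[_ hm] /andP[_ hp].
have fc := f_ge0 c; have fmc := f_ge0 (- c).
rewrite sqrrN in hm; rewrite exprMn in lo hi.
set k := K * c ^+ 2 in hm hp *.
(* f c >= 0 bounds the slope from below and f (- c) >= 0 from above *)
have lb : - (f 0 + k) <= c * df 0 by lra.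
have ub : c * df 0 <= f 0 + k by lra.
have lbs := ler_wpM2l s_ge0 lb; have ubs := ler_wpM2l s_ge0 ub.
have E : K * (s ^+ 2 * c ^+ 2) = s ^+ 2 * k by rewrite /k; ring.
rewrite E in lo hi; clearbody k; apply/andP; split; lra.
Qed.

(** Each coordinate move changes h + P by a factor between 1 - s and 1 + s, so n
    of them change it by at most (1 + s)^n - 1 times its initial value. *)
Lemma row_increment {R : realType} {n : nat} {h : 'rV[R]_n -> R} {c : 'rV[R]_n}
    {P s : R} (s_ge0 : 0 <= s)
    (step : forall (i : 'I_n) (z : 'rV[R]_n),
      `|h (z + (s * c ord0 i) *: 'e_i) - h z| <= s * (h z + P)) (z : 'rV[R]_n) :
  `|h (z + s *: c) - h z| <= ((1 + s) ^+ n - 1) * (h z + P).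
Proof.
suff H (l : seq 'I_n) (y : 'rV[R]_n) :
    `|h (y + \sum_(i <- l) (s * c ord0 i) *: 'e_i) - h y|
      <= ((1 + s) ^+ size l - 1) * (h y + P).
  have := H (enum 'I_n) z; rewrite size_enum_ord big_enum /=.
  rewrite [X in s *: X](row_sum_delta c) scaler_sumr.
  by under [X in _ -> `|h (_ + X) - _| <= _]eq_bigr do rewrite scalerA.
elim: l => [|i l IH] in y *.
  by rewrite big_nil addr0 subrr normr0 expr0 subrr mul0r.
rewrite big_cons /= exprS addrA.
set y1 := y + _; have := IH y1; have := step i y; rewrite -/y1.
set q := (1 + s) ^+ size l; have q1 : 1 <= q by rewrite exprn_ege1// lerDl.
rewrite !ler_norml => /andP[lo1 hi1] /andP[lo2 hi2].
have : (q - 1) * (h y1 + P) <= (q - 1) * ((1 + s) * (h y + P)).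
  by rewrite ler_wpM2l ?subr_ge0//; lra.
by move=> ?; apply/andP; split; lra.
Qed.

(** * Second derivatives of a symbol along the coordinate axes *)

Lemma is_derive_line {R : realType} {V : normedModType R} {f : V -> R}
    {X v : V} {r : R} :
  differentiable f (X + r *: v) ->
  is_derive r 1 (fun t : R => f (X + t *: v)) ('D_v f (X + r *: v)).
Proof.
move=> f_diff; have fd : derivable f (X + r *: v) v by exact: diff_derivable.
have E : (fun h : R => h^-1 *: (((fun t : R => f (X + t *: v)) \o shift r) (h *: (1 : R))
                       - f (X + r *: v)))
       = (fun h : R => h^-1 *: ((f \o shift (X + r *: v)) (h *: v) - f (X + r *: v))).
  apply/funext => h /=; congr (_ *: (f _ - _)).
  by rewrite scalerDl addrCA -[h *: 1]/(h * 1) mulr1.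
by apply: DeriveDef; rewrite /derivable /derive /= E; [exact: fd | reflexivity].
Qed.

(** [nonneg_increment] along the coordinate axis d through X. *)
Lemma smooth_line_increment {R : realType} {n : nat} {f : phase R n -> R}
    {d : 'I_n + 'I_n} {X : phase R n} {K : R}
    (f_smooth : smooth f) (f_ge0 : forall Y : phase R n, 0 <= f Y)
    (ddfK : forall r : R,
      `|partial d (partial d f) (X + r *: basis_vector R d)| <= K)
    (c s : R) (s_ge0 : 0 <= s) :
  `|f (X + (s * c) *: basis_vector R d) - f X|
    <= s * (f X + K * c ^+ 2 * (1 + s)).
Proof.
pose v := basis_vector R d.
have fd (t : R) : is_derive t 1 (fun u : R => f (X + u *: v))
    (partial d f (X + t *: v)) by exact/is_derive_line/(f_smooth [::]).
have dfd (t : R) : is_derive t 1 (fun u : R => partial d f (X + u *: v))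
    (partial d (partial d f) (X + t *: v)).
  exact/is_derive_line/(f_smooth [:: d]).
have := nonneg_increment fd dfd ddfK (fun t => f_ge0 _) c s s_ge0.
by rewrite scale0r addr0.
Qed.

Definition pure_index {n : nat} (i : 'I_n) (k : nat) : multi_index n :=
  [ffun j => if j == i then k else 0%N].

Lemma mi_order_pure_index {n : nat} (i : 'I_n) (k : nat) :
  mi_order (pure_index i k) = k.
Proof.
rewrite /mi_order (bigD1 i)//= ffunE eqxx big1 ?addn0// => j /negbTE ji.
by rewrite ffunE ji.
Qed.

Lemma partial_multi_pure_index {R : realType} {n : nat}
    (side : 'I_n -> 'I_n + 'I_n) (i : 'I_n) (k : nat) (f : phase R n -> R) :
  partial_multi side (pure_index i k) f = iter k (partial (side i)) f.
Proof.
rewrite /partial_multi; have := enum_uniq 'I_n.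
have : i \in enum 'I_n by rewrite mem_enum.
have skip (l : seq 'I_n) : i \notin l ->
    foldr (fun j h => iter (pure_index i k j) (partial (side j)) h) f l = f.
  elim: l => //= j l IH; rewrite inE negb_or eq_sym => /andP[/negbTE ji /IH ->].
  by rewrite ffunE ji.
elim: (enum 'I_n) => //= j l IH; rewrite inE ffunE => /orP[/eqP <-|il] /andP[jl ul].
- by rewrite skip// eqxx.
- by case: eqP jl => [->|_ _]; [rewrite il | exact: IH].
Qed.

(** Only multi-indices supported on one coordinate are used, so the order in which
    mixed derivatives are taken never matters. *)
Lemma symbol_pure_second_bounds {R : realType} {n : nat} {a2 : phase R n -> R} :
  kohn_nirenberg 2 a2 ->
  exists2 D : R, 0 <= D & forall (i : 'I_n) (X : phase R n),
    `|partial (inl i) (partial (inl i) a2) X| <= D * (1 + enorm X.2 ^+ 2) /\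
    `|partial (inr i) (partial (inr i) a2) X| <= D.
Proof.
move=> [_ a2_bd].
have en0 (u : 'rV[R]_n) : 0 <= enorm u by exact: sqrtr_ge0.
have [C1 C1P] := choice (fun i : 'I_n => a2_bd (pure_index i 0) (pure_index i 2)).
have [C2 C2P] := choice (fun i : 'I_n => a2_bd (pure_index i 2) (pure_index i 0)).
exists (2 * \sum_(i < n) `|C1 i| + \sum_(i < n) `|C2 i|).
  by rewrite addr_ge0 ?mulr_ge0 ?sumr_ge0.
have le_sum (C : 'I_n -> R) (i : 'I_n) : C i <= \sum_(j < n) `|C j|.
  by rewrite (bigD1 i)//= (le_trans (ler_norm _))// lerDl sumr_ge0.
have sum0 (C : 'I_n -> R) : 0 <= \sum_(j < n) `|C j| by rewrite sumr_ge0.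
move=> i X; split.
- have := C1P i X; rewrite /partial_x /partial_xi !partial_multi_pure_index /=.
  rewrite mi_order_pure_index subr0 => /le_trans; apply.
  rewrite -[(_ ^ 2)]/((1 + enorm X.2) ^+ 2).
  have := le_sum C1 i; have := sum0 C1; have := sum0 C2; have := en0 X.2.
  set e := enorm _; set S1 := \sum_(i < n) `|C1 i|; set S2 := \sum_(i < n) `|C2 i|.
  move=> e0 S20 S10 CS.
  apply: (@le_trans _ _ (S1 * (1 + e) ^+ 2)); first by rewrite ler_wpM2r ?sqr_ge0.
  have : 0 <= S1 * (1 - e) ^+ 2 by rewrite mulr_ge0 ?sqr_ge0.
  have : 0 <= S2 * (1 + e ^+ 2) by apply: mulr_ge0 => //; nra.
  lra.
- have := C2P i X; rewrite /partial_x /partial_xi !partial_multi_pure_index /=.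
  rewrite mi_order_pure_index subrr expr0z mulr1 => /le_trans; apply.
  by have := le_sum C2 i; have := sum0 C1; lra.
Qed.

(** * Increments of the symbol *)

Lemma enorm_sqE {R : realType} {n : nat} (u : 'rV[R]_n) :
  enorm u ^+ 2 = \sum_(i < n) u ord0 i ^+ 2.
Proof. by rewrite sqr_sqrtr; [|rewrite sumr_ge0// => i _; rewrite -expr2 sqr_ge0]. Qed.

Lemma enorm_sqZ {R : realType} {n : nat} (s : R) (u : 'rV[R]_n) :
  enorm (s *: u) ^+ 2 = s ^+ 2 * enorm u ^+ 2.
Proof. by rewrite !enorm_sqE mulr_sumr; under eq_bigr do rewrite mxE exprMn. Qed.

Lemma coord_le_enorm_sq {R : realType} {n : nat} (u : 'rV[R]_n) (i : 'I_n) :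
  u ord0 i ^+ 2 <= enorm u ^+ 2.
Proof.
by rewrite enorm_sqE (bigD1 i)//= lerDl sumr_ge0// => j _; rewrite sqr_ge0.
Qed.

Lemma enorm_sq_increment {R : realType} {n : nat} (s : R) (x t : 'rV[R]_n)
    (s_ge0 : 0 <= s) :
  `|enorm (x + s *: t) ^+ 2 - enorm x ^+ 2|
    <= s * (enorm x ^+ 2 + enorm t ^+ 2) + s ^+ 2 * enorm t ^+ 2.
Proof.
rewrite !enorm_sqE -sumrB -big_split /= !mulr_sumr -big_split /=.
rewrite (le_trans (ler_norm_sum _ _ _))// ler_sum// => i _; rewrite !mxE.
set a := x ord0 i; set b := t ord0 i.
have h1 : 0 <= s * (a + b) ^+ 2 by rewrite mulr_ge0 ?sqr_ge0.
have h2 : 0 <= s * (a - b) ^+ 2 by rewrite mulr_ge0 ?sqr_ge0.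
have h3 : 0 <= (s * b) ^+ 2 by rewrite sqr_ge0.
by rewrite ler_norml; apply/andP; split; lra.
Qed.

Lemma japanese_phase_sq {R : realType} {n : nat} (X : phase R n) :
  japanese_phase X ^+ 2 = 1 + enorm X.1 ^+ 2 + enorm X.2 ^+ 2.
Proof. by rewrite sqr_sqrtr// !addr_ge0 ?sqr_ge0. Qed.

Lemma japanese_phase_ge1 {R : realType} {n : nat} (X : phase R n) :
  1 <= japanese_phase X.
Proof. by rewrite -[leLHS]sqrtr1 ler_wsqrtr// -addrA lerDl addr_ge0 ?sqr_ge0. Qed.

(** The x-coordinates are moved first, while xi keeps its initial value, so that
    the second derivatives in x_i stay below D (1 + |xi|^2) with the initial xi;
    the second derivatives in xi_i are bounded uniformly.  Moving xi first would
    make the bound on the x-moves depend on s T. *)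
Lemma symbol_increment {R : realType} {n : nat} {a2 : phase R n -> R} {D : R}
    (a2_smooth : smooth a2) (a2_ge0 : forall X : phase R n, 0 <= a2 X)
    (D_ge0 : 0 <= D)
    (a2_bd : forall (i : 'I_n) (X : phase R n),
      `|partial (inl i) (partial (inl i) a2) X| <= D * (1 + enorm X.2 ^+ 2) /\
      `|partial (inr i) (partial (inr i) a2) X| <= D)
    (X T : phase R n) (P s : R) (s_ge0 : 0 <= s)
    (P1 : D * (1 + enorm X.2 ^+ 2) * enorm T.1 ^+ 2 <= P)
    (P2 : D * enorm T.2 ^+ 2 <= P) :
  `|a2 (X + s *: T) - a2 X| <= ((1 + s) ^+ (n + n) - 1) * (a2 X + P * (1 + s)).
Proof.
case: X T P1 P2 => [x xi] [t tau] /= P1 P2.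
have step_le (h k P' : R) : k <= P' -> s * (h + k * (1 + s)) <= s * (h + P' * (1 + s)).
  by move=> kP; rewrite ler_wpM2l// lerD2l ler_wpM2r// addr_ge0.
have Hx (i : 'I_n) (z : 'rV[R]_n) :
    `|a2 (z + (s * t ord0 i) *: 'e_i, xi) - a2 (z, xi)|
      <= s * (a2 (z, xi) + P * (1 + s)).
  have := @smooth_line_increment _ _ a2 (inl i) (z, xi) (D * (1 + enorm xi ^+ 2))
    a2_smooth a2_ge0 _ (t ord0 i) s s_ge0.
  have -> : (z, xi) + (s * t ord0 i) *: basis_vector R (inl i)
      = (z + (s * t ord0 i) *: 'e_i, xi) by congr pair; rewrite /= scaler0 addr0.
  move=> H; apply: le_trans (H _) _ => [r|].
    have := (a2_bd i ((z, xi) + r *: basis_vector R (inl i))).1.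
    by rewrite /= scaler0 addr0.
  apply/step_le/(le_trans _ P1); rewrite ler_wpM2l ?coord_le_enorm_sq//.
  by rewrite mulr_ge0// addr_ge0 ?sqr_ge0.
have Hxi (i : 'I_n) (z : 'rV[R]_n) :
    `|a2 (x + s *: t, z + (s * tau ord0 i) *: 'e_i) - a2 (x + s *: t, z)|
      <= s * (a2 (x + s *: t, z) + P * (1 + s)).
  have := @smooth_line_increment _ _ a2 (inr i) (x + s *: t, z) D
    a2_smooth a2_ge0 _ (tau ord0 i) s s_ge0.
  have -> : (x + s *: t, z) + (s * tau ord0 i) *: basis_vector R (inr i)
      = (x + s *: t, z + (s * tau ord0 i) *: 'e_i).
    by congr pair; rewrite /= scaler0 addr0.
  move=> H; apply: le_trans (H _) _ => [r|]; first exact: (a2_bd _ _).2.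
  by apply/step_le/(le_trans _ P2); rewrite ler_wpM2l ?coord_le_enorm_sq.
have := row_increment (h := fun z => a2 (z, xi)) s_ge0 Hx x.
have := row_increment (h := fun z => a2 (x + s *: t, z)) s_ge0 Hxi xi.
have -> : (x, xi) + s *: (t, tau) = (x + s *: t, xi + s *: tau) by [].
rewrite exprD; set q := (1 + s) ^+ n.
have q1 : 1 <= q by rewrite exprn_ege1// lerDl.
set f0 := a2 (x, xi); set f1 := a2 (_, xi); set f2 := a2 _; set p := P * _.
rewrite !ler_norml => /andP[lo2 hi2] /andP[lo1 hi1].
have : (q - 1) * (f1 + p) <= (q - 1) * (q * (f0 + p)).
  by rewrite ler_wpM2l ?subr_ge0//; lra.
by move=> ?; apply/andP; split; lra.
Qed.

(** * Increments of the weight *)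

(** Makes the bounds of the shape (1 + s)^k - 1 visibly linear in s near 0. *)
Lemma expr_increment_le {R : realType} (s : R) (k : nat) (s_ge0 : 0 <= s) :
  (1 + s) ^+ k - 1 <= k%:R * s * (1 + s) ^+ k.
Proof.
elim: k => [|k IH]; first by rewrite expr0 subrr !mul0r.
rewrite exprS -[k.+1%:R]natr1; set q := (1 + s) ^+ k in IH *.
have q1 : 1 <= q by rewrite exprn_ege1// lerDl.
have h : 0 <= s * (q * s) by rewrite !mulr_ge0// (le_trans _ q1).
have h' : 0 <= s * (q - 1) by rewrite mulr_ge0// subr_ge0.
have : (1 + s) * (q - 1) <= (1 + s) * (k%:R * s * q).
  by rewrite ler_wpM2l// addr_ge0.
by lra.
Qed.

(** The squares of the two brackets differ by at most
    s (<X>^2 + |T|^2) + s^2 |T|^2, which is at most (2 s + s^2) M <X> because M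
    dominates both <X> and |T|^2 and <X> >= 1.  It remains to divide by the sum of
    the brackets, which is at least <X>. *)
Lemma japanese_phase_increment {R : realType} {n : nat} (X T : phase R n)
    (M s : R) (s_ge0 : 0 <= s) (LM : japanese_phase X <= M)
    (TM : enorm T.1 ^+ 2 + enorm T.2 ^+ 2 <= M) :
  `|japanese_phase (X + s *: T) - japanese_phase X| <= (2 * s + s ^+ 2) * M.
Proof.
have := enorm_sq_increment s X.1 T.1 s_ge0.
have := enorm_sq_increment s X.2 T.2 s_ge0.
have := japanese_phase_sq X; have := japanese_phase_sq (X + s *: T).
have := japanese_phase_ge1 X; have := japanese_phase_ge1 (X + s *: T).
rewrite [(X + s *: T).1]/(X.1 + s *: T.1) [(X + s *: T).2]/(X.2 + s *: T.2).
set L' := japanese_phase (X + _); set L := japanese_phase X in LM *.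
set x' := enorm (X.1 + _) ^+ 2; set y' := enorm (X.2 + _) ^+ 2.
move: (enorm X.1 ^+ 2) (enorm X.2 ^+ 2) => x y.
move: TM; move: (enorm T.1 ^+ 2) (enorm T.2 ^+ 2) => t u TM.
move=> L'1 L1 L'E LE hy hx.
(* multiply by L' + L to compare the squares *)
have pos : 0 < L' + L by lra.
rewrite -(ler_pM2r pos) -{1}[L' + L](ger0_norm (ltW pos)) -normrM.
have -> : (L' - L) * (L' + L) = (x' - x) + (y' - y) by lra.
apply: le_trans (ler_normD _ _) _.
apply: le_trans (lerD hx hy) _.
have h1 : s * (t + u) <= s * M by rewrite ler_wpM2l.
have h2 : s ^+ 2 * (t + u) <= s ^+ 2 * M by rewrite ler_wpM2l ?sqr_ge0.
have h3 : s * (x + y) <= s * (L * M) by rewrite ler_wpM2l//; nra.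
have M_ge0 : 0 <= M by lra.
have h4 : 0 <= (s * M) * (L - 1) by rewrite !mulr_ge0 ?subr_ge0.
have h5 : 0 <= (s ^+ 2 * M) * (L - 1) by rewrite !mulr_ge0 ?subr_ge0 ?sqr_ge0.
have h6 : 0 <= (2 * s + s ^+ 2) * M * L'.
  by rewrite !mulr_ge0 ?addr_ge0 ?mulr_ge0 ?sqr_ge0//; lra.
lra.
Qed.

(** The metric of the theorem, for an arbitrary weight. *)
Definition weight_metric {R : realType} {n : nat} (m : phase R n -> R) :
    phase R n -> phase R n -> R :=
  split_metric
    (fun X : phase R n => (m X)^-1 * (japanese X.2 ^+ 2 + enorm X.1 ^+ 2))
    (fun X : phase R n => (m X)^-1).

(** The numerator m(X) g_X(T) of the metric, free of the weight. *)
Definition anisotropic_sq {R : realType} {n : nat} (X T : phase R n) : R :=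
  japanese_phase X ^+ 2 * enorm T.1 ^+ 2 + enorm T.2 ^+ 2.

Lemma japanese_sq_addE {R : realType} {n : nat} (X : phase R n) :
  japanese X.2 ^+ 2 + enorm X.1 ^+ 2 = japanese_phase X ^+ 2.
Proof.
have -> : japanese X.2 ^+ 2 = 1 + enorm X.2 ^+ 2.
  by rewrite /japanese sqr_sqrtr// addr_ge0 ?sqr_ge0.
by rewrite japanese_phase_sq addrAC.
Qed.

Lemma weight_metricE {R : realType} {n : nat} (m : phase R n -> R)
    (X T : phase R n) :
  weight_metric m X T = (m X)^-1 * anisotropic_sq X T.
Proof.
by rewrite /weight_metric /split_metric japanese_sq_addE /anisotropic_sq; ring.
Qed.

Lemma anisotropic_sq_ge {R : realType} {n : nat} (X T : phase R n) :
  enorm T.1 ^+ 2 + enorm T.2 ^+ 2 <= anisotropic_sq X T.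
Proof.
by rewrite lerD2r ler_peMl ?sqr_ge0// expr_ge1 ?japanese_phase_ge1// sqrtr_ge0.
Qed.

Lemma anisotropic_sq_ge0 {R : realType} {n : nat} (X T : phase R n) :
  0 <= anisotropic_sq X T.
Proof. by rewrite /anisotropic_sq addr_ge0 ?sqr_ge0// mulr_ge0 ?sqr_ge0. Qed.

Lemma anisotropic_sqZ {R : realType} {n : nat} (s : R) (X T : phase R n) :
  anisotropic_sq X (s *: T) = s ^+ 2 * anisotropic_sq X T.
Proof. by rewrite /anisotropic_sq !enorm_sqZ; ring. Qed.

(** With g_X(T) <= 1, the hypotheses of [symbol_increment] hold with P = D m(X),
    and the increments of |x|^2 and <X> are O((s + s^2) m(X)). *)
Lemma symbol_weight_increment {R : realType} {n : nat} {a2 : phase R n -> R}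
    (a2_symbol : kohn_nirenberg 2 a2) (a2_ge0 : forall X : phase R n, 0 <= a2 X) :
  let m := fun X : phase R n => a2 X + enorm X.1 ^+ 2 + japanese_phase X in
  exists2 E : R, 0 <= E & exists N : nat, forall (X T : phase R n) (s : R),
    0 <= s -> anisotropic_sq X T <= m X ->
    `|m (X + s *: T) - m X| <= E * (s * (1 + s) ^+ N) * m X.
Proof.
move=> m; have [D D0 a2_bd] := symbol_pure_second_bounds a2_symbol.
exists ((n + n)%:R * (1 + D) + 4); first by rewrite addr_ge0// mulr_ge0// addr_ge0.
exists (n + n).+1 => X T s s0 TM.
have T_le : enorm T.1 ^+ 2 + enorm T.2 ^+ 2 <= m X.
  exact: le_trans (anisotropic_sq_ge X T) TM.
have L1 := japanese_phase_ge1 X; have x0 := sqr_ge0 (enorm X.1).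
have a0 := a2_ge0 X; have t0 := sqr_ge0 (enorm T.1); have u0 := sqr_ge0 (enorm T.2).
have Lm : japanese_phase X <= m X by rewrite /m; lra.
have am : a2 X <= m X by rewrite /m; lra.
have xm : enorm X.1 ^+ 2 <= m X by rewrite /m; lra.
have m0 : 0 <= m X by lra.
have hL := japanese_phase_increment X T (m X) s s0 Lm T_le.
have hx := enorm_sq_increment s X.1 T.1 s0.
have P1 : D * (1 + enorm X.2 ^+ 2) * enorm T.1 ^+ 2 <= D * m X.
  rewrite -mulrA ler_wpM2l// (le_trans _ TM)//.
  by rewrite /anisotropic_sq japanese_phase_sq; nra.
have P2 : D * enorm T.2 ^+ 2 <= D * m X by rewrite ler_wpM2l//; lra.
have ha := symbol_increment a2_symbol.1 a2_ge0 D0 a2_bd X T (D * m X) s s0 P1 P2.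
have -> : m (X + s *: T) - m X = (a2 (X + s *: T) - a2 X)
   + (enorm (X.1 + s *: T.1) ^+ 2 - enorm X.1 ^+ 2)
   + (japanese_phase (X + s *: T) - japanese_phase X) by rewrite /m /=; ring.
apply: le_trans (ler_normD _ _) _; apply: le_trans (lerD (ler_normD _ _) hL) _.
rewrite [(1 + s) ^+ _.+1]exprSr; have := expr_increment_le s (n + n) s0.
have : 1 <= (1 + s) ^+ (n + n) by rewrite exprn_ege1// lerDl.
move: ha; set q := (1 + s) ^+ _; set k := (n + n)%:R => ha q1 hk.
have q10 : 0 <= q - 1 by lra.
have ha' : `|a2 (X + s *: T) - a2 X| <= k * s * q * ((1 + D) * m X * (1 + s)).
  apply: le_trans ha _; apply: ler_pM => //.
    by apply: addr_ge0 => //; apply: mulr_ge0; [exact: mulr_ge0 | exact: addr_ge0].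
  by have := mulr_ge0 s0 m0; lra.
have h1 : s * enorm X.1 ^+ 2 <= s * m X by rewrite ler_wpM2l.
have h2 : s * enorm T.1 ^+ 2 <= s * m X by rewrite ler_wpM2l//; lra.
have h3 : s ^+ 2 * enorm T.1 ^+ 2 <= s ^+ 2 * m X.
  by rewrite ler_wpM2l ?sqr_ge0//; lra.
have h4 : 0 <= (q - 1) * (s * (1 + s) * m X).
  by apply: mulr_ge0 => //; apply: mulr_ge0 => //; apply: mulr_ge0 => //; lra.
have h5 : 0 <= s ^+ 2 * m X by rewrite mulr_ge0 ?sqr_ge0.
by lra.
Qed.

(** * The dual metric *)

Lemma enorm_sq_eq0 {R : realType} {n : nat} (u : 'rV[R]_n) :
  (enorm u ^+ 2 == 0) = (u == 0).
Proof.
apply/eqP/eqP => [u0|->].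
  apply/rowP => i; rewrite mxE; apply/eqP; rewrite -sqrf_eq0 eq_le sqr_ge0 andbT.
  by rewrite -u0 coord_le_enorm_sq.
by rewrite enorm_sqE big1// => i _; rewrite mxE expr0n.
Qed.

Lemma enorm_sq_dotp {R : realType} {n : nat} (u : 'rV[R]_n) :
  dotp u u = enorm u ^+ 2.
Proof. by rewrite enorm_sqE; apply: eq_bigr => i _; rewrite expr2. Qed.

(** Testing the supremum on W = (0, t) and on W = (tau, 0) gives
    |t|^2 / B and |tau|^2 / A; their mean is a lower bound even when t or tau
    vanishes, provided that some W <> 0 exists, that is, n > 0. *)
Lemma dual_metric_ge {R : realType} {n : nat} (A B : phase R n -> R)
    (X T : phase R n) (n_gt0 : (0 < n)%N) (A_gt0 : 0 < A X) (B_gt0 : 0 < B X) :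
  (((enorm T.1 ^+ 2 / B X + enorm T.2 ^+ 2 / A X) / 2)%:E
    <= dual_metric (split_metric A B) X T)%E.
Proof.
set D := dual_metric _ _ _.
have DW (W : phase R n) : W != 0 ->
    ((symp T W ^+ 2 / split_metric A B X W)%:E <= D)%E.
  by move=> W0; apply: ereal_sup_ubound; exists W.
have dot0l (u : 'rV[R]_n) : dotp 0 u = 0.
  by rewrite /dotp big1// => i _; rewrite mxE mul0r.
have dot0r (u : 'rV[R]_n) : dotp u 0 = 0.
  by rewrite /dotp big1// => i _; rewrite mxE mulr0.
have en00 : enorm (0 : 'rV[R]_n) ^+ 2 = 0 by apply/eqP; rewrite enorm_sq_eq0.
have D_ge0 : (0 <= D)%E.
  have /DW : (const_mx 1, 0) != 0 :> phase R n.
    apply/negP => /eqP[] /rowP/(_ (Ordinal n_gt0)); rewrite !mxE => /eqP.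
    by rewrite oner_eq0.
  apply: le_trans; rewrite lee_fin mulr_ge0 ?sqr_ge0// invr_ge0.
  by rewrite /split_metric /= addr_ge0// mulr_ge0 ?sqr_ge0 ?ltW.
have D1 : ((enorm T.1 ^+ 2 / B X)%:E <= D)%E.
  have [T0|T0] := eqVneq T.1 0; first by rewrite T0 en00 mul0r.
  have /DW : (0, T.1) != 0 :> phase R n.
    by apply: contra T0 => /eqP[->].
  apply: le_trans; rewrite lee_fin /symp /split_metric /= dot0l en00 mulr0 !add0r.
  rewrite sqrrN enorm_sq_dotp.
  have : enorm T.1 ^+ 2 != 0 by rewrite enorm_sq_eq0.
  move: (enorm T.1 ^+ 2) => q q0.
  rewrite le_eqVlt; apply/orP; left; apply/eqP; field.
  by rewrite q0 gt_eqF.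
have D2 : ((enorm T.2 ^+ 2 / A X)%:E <= D)%E.
  have [T0|T0] := eqVneq T.2 0; first by rewrite T0 en00 mul0r.
  have /DW : (T.2, 0) != 0 :> phase R n.
    by apply: contra T0 => /eqP[->].
  apply: le_trans; rewrite lee_fin /symp /split_metric /= dot0r en00 mulr0 addr0.
  rewrite subr0 enorm_sq_dotp.
  have : enorm T.2 ^+ 2 != 0 by rewrite enorm_sq_eq0.
  move: (enorm T.2 ^+ 2) => q q0.
  rewrite le_eqVlt; apply/orP; left; apply/eqP; field.
  by rewrite q0 gt_eqF.
have [ab|/ltW ab] := leP (enorm T.1 ^+ 2 / B X) (enorm T.2 ^+ 2 / A X).
- by apply: le_trans D2; rewrite lee_fin; lra.
- by apply: le_trans D1; rewrite lee_fin; lra.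
Qed.

(** Reduces temperance, whose bound involves a possibly infinite dual metric, to an
    inequality between real numbers. *)
Lemma lee_temperate_bound {R : realType} (C v c : R) (D : \bar R) (N : nat)
    (C_ge0 : 0 <= C) (c_ge0 : 0 <= c) (cD : (c%:E <= D)%E)
    (vc : v <= C * (1 + c) ^+ N) :
  (v%:E <= C%:E * (1 + D) ^+ N)%E.
Proof.
have c1 : (0 <= (1 + c)%:E)%E by rewrite lee_fin addr_ge0.
have cD1 : ((1 + c)%:E <= 1 + D)%E by rewrite EFinD leeD2l.
suff H : (((1 + c) ^+ N)%:E <= (1 + D) ^+ N)%E.
  apply: (@le_trans _ _ (C%:E * ((1 + c) ^+ N)%:E)%E); first by rewrite -EFinM lee_fin.
  by apply: lee_pmul => //; rewrite lee_fin// exprn_ge0// addr_ge0.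
rewrite EFin_expe; elim: N {vc} => [|N IH]; first by rewrite !expe0.
by rewrite !expeS; apply: lee_pmul => //; exact: expe_ge0.
Qed.

(** * From the increment estimate to a weight for the metric *)

(** The estimate of [symbol_weight_increment], with the condition g_X(T) <= 1
    cleared of its denominator. *)
Definition weight_increment {R : realType} {n : nat} (m : phase R n -> R)
    (E : R) (N : nat) : Prop :=
  forall (X T : phase R n) (s : R), 0 <= s -> anisotropic_sq X T <= m X ->
    `|m (X + s *: T) - m X| <= E * (s * (1 + s) ^+ N) * m X.

Lemma anisotropic_sqC {R : realType} {n : nat} (Z X Y : phase R n) :
  anisotropic_sq Z (X - Y) = anisotropic_sq Z (Y - X).
Proof. by rewrite -opprB -scaleN1r anisotropic_sqZ sqrrN expr1n mul1r. Qed.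

Lemma weight_increment_rescaled {R : realType} {n : nat} {m : phase R n -> R}
    {E : R} {N : nat} (mP : weight_increment m E N) (X Y : phase R n) (s : R)
    (s_gt0 : 0 < s) (XY : anisotropic_sq X (Y - X) <= s ^+ 2 * m X) :
  `|m Y - m X| <= E * (s * (1 + s) ^+ N) * m X.
Proof.
have := mP X (s^-1 *: (Y - X)) s (ltW s_gt0).
rewrite scalerA divff ?gt_eqF// scale1r [X + _]addrC subrK; apply.
by rewrite anisotropic_sqZ exprVn ler_pdivrMl// exprn_gt0.
Qed.

(** The radius r is small enough for E r (1 + r)^N <= 1 / 2. *)
Lemma weight_comparable_nearby {R : realType} {n : nat} {m : phase R n -> R}
    {E : R} {N : nat} (E_ge0 : 0 <= E) (mP : weight_increment m E N)
    (m_gt0 : forall X : phase R n, 0 < m X) :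
  exists2 r : R, 0 < r <= 1 / 2 & forall X Y : phase R n,
    anisotropic_sq X (Y - X) <= r ^+ 2 * m X -> m X <= 2 * m Y /\ m Y <= 2 * m X.
Proof.
have p0 : 0 <= E * 2 ^+ N by rewrite mulr_ge0// exprn_ge0.
exists (2 * (E * 2 ^+ N) + 2)^-1.
  rewrite invr_gt0 div1r lef_pV2 ?posrE; lra.
set r := _^-1 => X Y /weight_increment_rescaled -/(_ E N mP).
have rE : r * (2 * (E * 2 ^+ N) + 2) = 1 by rewrite mulVf// gt_eqF//; lra.
have r0 : 0 < r by rewrite invr_gt0; lra.
have r1 : r <= 1 by nra.
move=> /(_ r0) mXY.
have rN : (1 + r) ^+ N <= 2 ^+ N by rewrite lerXn2r ?nnegrE//; lra.
have h : E * (r * (1 + r) ^+ N) <= 1 / 2.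
  have : E * r * (1 + r) ^+ N <= E * r * 2 ^+ N.
    by rewrite ler_wpM2l// mulr_ge0// ltW.
  by lra.
have := le_trans mXY (ler_wpM2r (ltW (m_gt0 X)) h).
by rewrite ler_norml => /andP[? ?]; have := m_gt0 X; split; lra.
Qed.

Lemma weight_metric_continuous {R : realType} {n : nat} {m : phase R n -> R}
    {E : R} {N : nat} (E_ge0 : 0 <= E) (mP : weight_increment m E N)
    (m_gt0 : forall X : phase R n, 0 < m X) :
  g_continuous (weight_metric m) m.
Proof.
have [r /andP[r0 r12] near_cmp] := weight_comparable_nearby E_ge0 mP m_gt0.
have r2 : 0 < r ^+ 2 by rewrite exprn_gt0.
have C2 : 2 <= (r ^+ 2)^-1 by rewrite -[leLHS]invrK lef_pV2 ?posrE//; nra.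
exists (r ^+ 2)^-1; first by rewrite invr_gt0.
move=> X Y; rewrite weight_metricE div1r invrK ler_pdivrMl// mulrC anisotropic_sqC.
move=> /near_cmp[XY YX]; rewrite invf_div; have mX := m_gt0 X; have mY := m_gt0 Y.
by split; rewrite ler_pdivrMr// (le_trans _ (ler_wpM2r (ltW _) C2)).
Qed.

(** The increment estimate from Y with s = 1 + 2 c: the bound on X - Y says that
    g_Y(X - Y) <= 2 c, which is at most s^2. *)
Lemma weight_le_temperate {R : realType} {n : nat} {m : phase R n -> R}
    {E : R} {N : nat} (E_ge0 : 0 <= E) (mP : weight_increment m E N)
    (m_gt0 : forall X : phase R n, 0 < m X) (X Y : phase R n) (c : R)
    (c_ge : anisotropic_sq Y (X - Y) <= 2 * c * m Y) (c_ge0 : 0 <= c) :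
  m X <= (1 + E * 2 ^+ N.+1) * (1 + c) ^+ N.+1 * m Y.
Proof.
have s0 : 0 < 1 + 2 * c by lra.
have mY := m_gt0 Y.
have : anisotropic_sq Y (X - Y) <= (1 + 2 * c) ^+ 2 * m Y.
  by apply: le_trans c_ge _; rewrite ler_wpM2r ?ltW//; nra.
move=> /(weight_increment_rescaled mP _ _ _ s0); rewrite ler_norml => /andP[_ hi].
have hs : (1 + 2 * c) * (1 + (1 + 2 * c)) ^+ N <= 2 ^+ N.+1 * (1 + c) ^+ N.+1.
  rewrite -exprMn exprS; apply: ler_pM; [lra|rewrite exprn_ge0//; lra|lra|].
  by rewrite lerXn2r ?nnegrE//; lra.
have c1 : 1 <= (1 + c) ^+ N.+1 by rewrite exprn_ege1// lerDl.
have := ler_wpM2r (ltW mY) (ler_wpM2l E_ge0 hs).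
have := ler_wpM2r (ltW mY) c1.
by lra.
Qed.

(** Since |Y - X|^2 is linear in <Y>, the triangle inequality
    <Y>^2 <= 2 <X>^2 + 2 |Y - X|^2 is quadratic in <Y> and can be solved. *)
Lemma japanese_phase_le_temperate {R : realType} {n : nat} (X Y : phase R n)
    (c : R) (c_ge0 : 0 <= c)
    (c_ge : enorm (Y - X).1 ^+ 2 + enorm (Y - X).2 ^+ 2 <= 2 * c * japanese_phase Y) :
  japanese_phase Y <= 5 * (japanese_phase X * (1 + c)).
Proof.
have := enorm_sq_increment 1 X.1 (Y - X).1 ler01.
have := enorm_sq_increment 1 X.2 (Y - X).2 ler01.
have := japanese_phase_sq X; have := japanese_phase_sq Y.
have := japanese_phase_ge1 X; have := japanese_phase_ge1 Y.
have -> : X.1 + 1 *: (Y - X).1 = Y.1 by rewrite scale1r [X.1 + _]addrC subrK.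
have -> : X.2 + 1 *: (Y - X).2 = Y.2 by rewrite scale1r [X.2 + _]addrC subrK.
rewrite !ler_norml expr1n !mul1r.
move: c_ge; set L' := japanese_phase Y; set L := japanese_phase X.
move=> c_ge L'1 L1 L'E LE /andP[_ hy] /andP[_ hx].
have LG : 1 + c <= L * (1 + c) by rewrite ler_peMl//; lra.
have LG' : L <= L * (1 + c) by rewrite ler_peMr//; lra.
set K := L * (1 + c) in LG LG' *.
have h1 : L' ^+ 2 <= 2 * L ^+ 2 + 4 * c * L' by lra.
have h2 : L ^+ 2 <= K ^+ 2 by rewrite lerXn2r ?nnegrE//; lra.
have h3 : c * L' <= K * L' by rewrite ler_wpM2r//; lra.
clearbody K L L'; nra.
Qed.

(** Here 2 c bounds the dual metric at X - Y.  The two hypotheses on X - Y combine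
    into r^2 m(Y)^2 <= 2 c <Y>^2, so m(Y) exceeds <Y> at most by a factor
    O(1 + c), and <Y> is compared with <X> <= m(X). *)
Lemma weight_ge_temperate {R : realType} {n : nat} {m : phase R n -> R}
    (m_ge : forall X : phase R n, japanese_phase X <= m X) (r : R)
    (r_gt0 : 0 < r) (X Y : phase R n) (c : R) (c_ge0 : 0 <= c)
    (far : r ^+ 2 * m Y <= anisotropic_sq Y (X - Y))
    (cE : m Y * anisotropic_sq Y (X - Y) <= 2 * c * japanese_phase Y ^+ 2) :
  m Y <= 10 / r * (1 + c) ^+ 2 * m X.
Proof.
have L1 := japanese_phase_ge1 Y; have Lm := m_ge Y.
have LX1 := japanese_phase_ge1 X; have LmX := m_ge X.
have LL : japanese_phase Y <= 5 * (japanese_phase X * (1 + c)).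
  apply: japanese_phase_le_temperate => //.
  apply: le_trans (anisotropic_sq_ge Y _) _; rewrite anisotropic_sqC.
  have Q0 := anisotropic_sq_ge0 Y (X - Y).
  rewrite -(@ler_pM2l _ (japanese_phase Y)); last by lra.
  by apply: (le_trans (ler_wpM2r Q0 Lm)); lra.
have rm : r * m Y <= 2 * (japanese_phase Y * (1 + c)).
  rewrite -(@ler_pXn2r _ 2) ?nnegrE//.
  - have : m Y * (r ^+ 2 * m Y) <= m Y * anisotropic_sq Y (X - Y).
      by rewrite ler_wpM2l//; lra.
    have : c * japanese_phase Y ^+ 2 <= (1 + c) ^+ 2 * japanese_phase Y ^+ 2.
      by rewrite ler_wpM2r ?sqr_ge0//; nra.
    have : 0 <= ((1 + c) * japanese_phase Y) ^+ 2 by rewrite sqr_ge0.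
    by lra.
  - by rewrite mulr_ge0//; lra.
  - by rewrite mulr_ge0// mulr_ge0//; lra.
rewrite -(ler_pM2l r_gt0) (le_trans rm)//.
have -> : r * (10 / r * (1 + c) ^+ 2 * m X) = 10 * (m X * (1 + c) ^+ 2).
  by field; rewrite gt_eqF.
have h1 : japanese_phase Y * (1 + c) <= 5 * (japanese_phase X * (1 + c)) * (1 + c).
  by rewrite ler_wpM2r//; lra.
have h2 : japanese_phase X * (1 + c) ^+ 2 <= m X * (1 + c) ^+ 2.
  by rewrite ler_wpM2r ?sqr_ge0.
by lra.
Qed.

Lemma weight_metric_temperate {R : realType} {n : nat} {m : phase R n -> R}
    {E : R} {N : nat} (E_ge0 : 0 <= E) (mP : weight_increment m E N)
    (m_ge : forall X : phase R n, japanese_phase X <= m X) :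
  g_temperate (weight_metric m) m.
Proof.
have L_gt0 (X : phase R n) : 0 < japanese_phase X.
  exact: lt_le_trans ltr01 (japanese_phase_ge1 X).
have m_gt0 (X : phase R n) : 0 < m X by exact: lt_le_trans (m_ge X).
(* for n = 0 the dual metric is the supremum of the empty set, but X = Y *)
have [n0|n_gt0] := posnP n.
  subst n; exists 1 => //; exists 0%N => X Y.
  have -> : X = Y by case: X Y => [x xi] [y eta]; congr pair; rewrite !thinmx0.
  by rewrite divff ?gt_eqF// invr1 !expe0 mule1.
have [r /andP[r0 _] near_cmp] := weight_comparable_nearby E_ge0 mP m_gt0.
(* the sum of the constants of the three cases: upper bound, far, near *)
pose C := 1 + E * 2 ^+ N.+1 + 10 / r + 2.
have e0 : 0 <= E * 2 ^+ N.+1 by rewrite mulr_ge0// exprn_ge0.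
have i0 : 0 <= 10 / r by rewrite divr_ge0// ltW.
have C0 : 0 < C by rewrite /C; lra.
exists C => //; exists N.+2 => X Y bound.
have mX := m_gt0 X; have mY := m_gt0 Y; have LY := L_gt0 Y; have LmY := m_ge Y.
set Q := anisotropic_sq Y (X - Y).
have Q0 : 0 <= Q by exact: anisotropic_sq_ge0.
(* half of the dual metric at X - Y *)
pose c := m Y * Q / (2 * japanese_phase Y ^+ 2).
have L20 : 0 < japanese_phase Y ^+ 2 by rewrite exprn_gt0.
have cE : m Y * Q = 2 * c * japanese_phase Y ^+ 2.
  by rewrite /c; field; rewrite gt_eqF.
have c0 : 0 <= c.
  by rewrite /c divr_ge0//; [rewrite mulr_ge0// ltW|rewrite mulr_ge0// ltW].
have cD : (c%:E <= dual_metric (weight_metric m) Y (X - Y)%R)%E.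
  apply: le_trans (dual_metric_ge _ _ Y (X - Y) n_gt0 _ _); last first.
  - by rewrite invr_gt0.
  - by rewrite japanese_sq_addE mulr_gt0 ?invr_gt0.
  rewrite lee_fin japanese_sq_addE /c /Q /anisotropic_sq le_eqVlt.
  by apply/orP; left; apply/eqP; field; rewrite !gt_eqF.
have G1 : 1 <= 1 + c by rewrite lerDl.
have widen (k : nat) (v a : R) : (k <= N.+2)%N -> a <= C -> 0 <= v ->
    a * (1 + c) ^+ k * v <= C * (1 + c) ^+ N.+2 * v.
  move=> kN aC v0; rewrite ler_wpM2r//.
  apply: (@le_trans _ _ (C * (1 + c) ^+ k)).
    by rewrite ler_wpM2r// exprn_ge0// addr_ge0.
  by rewrite ler_wpM2l ?(ltW C0)// ler_weXn2l.
split; apply: (lee_temperate_bound _ _ c) => //; rewrite ?(ltW C0)//.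
- rewrite ler_pdivrMr//.
  apply: le_trans (weight_le_temperate E_ge0 mP m_gt0 X Y c _ c0) _.
    rewrite -(@ler_pM2l _ (m Y))// cE expr2.
    have : japanese_phase Y ^+ 2 <= m Y ^+ 2.
      by rewrite lerXn2r ?nnegrE// ltW.
    move=> /(ler_wpM2l c0); rewrite !expr2; lra.
  by apply: widen => //; [rewrite /C; lra|exact: ltW].
- rewrite invf_div ler_pdivrMr//.
  have [far|/ltW] := leP (r ^+ 2 * m Y) Q.
    apply: le_trans (weight_ge_temperate m_ge r r0 X Y c c0 far _) _; first by rewrite cE.
    by apply: widen => //; [rewrite /C; lra|exact: ltW].
  rewrite /Q anisotropic_sqC => close.
  have [|mYX _] := near_cmp Y X; first by rewrite anisotropic_sqC.
  apply: le_trans mYX _; rewrite -[2]mulr1 -(expr0 (1 + c)).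
  by apply: widen => //; [rewrite /C; lra|exact: ltW].
Qed.

Theorem corollary3p4 (R : realType) (n : nat) (a2 : phase R n -> R)
    (a2_symbol : kohn_nirenberg 2 a2)
    (a2_ge0 : forall X : phase R n, 0 <= a2 X) :
  let a := fun X : phase R n => a2 X + enorm X.1 ^+ 2 in
  let m := fun X : phase R n => a X + japanese_phase X in
  let g := split_metric
    (fun X : phase R n => (m X)^-1 * (japanese X.2 ^+ 2 + enorm X.1 ^+ 2))
    (fun X : phase R n => (m X)^-1) in
  g_weight g m.
Proof.
move=> a m g.
have [E E_ge0 [N mP]] := symbol_weight_increment a2_symbol a2_ge0.
have m_ge (X : phase R n) : japanese_phase X <= m X.
  by rewrite lerDr addr_ge0 ?sqr_ge0.
have m_gt0 (X : phase R n) : 0 < m X.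
  exact: lt_le_trans (lt_le_trans ltr01 (japanese_phase_ge1 X)) (m_ge X).
split=> //.
- exact: weight_metric_continuous E_ge0 mP m_gt0.
- exact: weight_metric_temperate E_ge0 mP m_ge.
Qed.
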